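(* Let $(K_1,E_1)$ and $(K_2,E_2)$ be o-minimal $\mathrm{EXP}$-fields and suppose that $(K_2,E_2)$ satisfies the existential $\mathcal{L}_{\exp}$-theory of $(K_1,E_1)$. Then there exists an $\mathcal{L}_{\exp}$-embedding of the ordered exponential field $(\mathrm{ecl}^{E_1}_{K_1}(\emptyset),E_1)$ into $(K_2,E_2)$.
   Context: $\mathcal{L}_{\exp}=\{+,-,\cdot,0,1,<,E\}$ with $E$ a unary function symbol. An ordered exponential field $(K,E)$ is an ordered field with an order-preserving isomorphism $E$ from $(K,+,0,<)$ onto $(K^{>0},\cdot,1,<)$; it is an $\mathrm{EXP}$-field if $E$ satisfies the first-order sentence expressing $E'=E$, and o-minimal if every definable (with parameters) subset of $K$ is a finite union of points and open intervals. The existential theory of a structure is the set of existential sentences true in it. An $E$-ring is a subring of $K$ closed under $E$; for an $E$-ring $A$, $A[x_1,\dots,x_n]^{E}$ is the smallest ring containing $A[x_1,\dots,x_n]$ closed under applying $E$. A Khovanskii system over $A$ of $f_1,\dots,f_n\in A[x_1,\dots,x_n]^{E}$ is the system $f_1(\underline{x})=\dots=f_n(\underline{x})=0$, $\det(\partial f_i/\partial x_j(\underline{x}))_{i,j}\neq0$. For $B\subseteq K$ with $A$ the smallest $E$-ring containing $B$, $a_1\in K$ is exponentially algebraic over $B$ if there are $n$, a Khovanskii system $S(x_1,\dots,x_n)$ over $A$ and $a_2,\dots,a_n\in K$ with $(a_1,\dots,a_n)$ solving $S$; $\mathrm{ecl}^{E}_K(B)$ is the set of such elements. In particular $\mathrm{ecl}^{E}_K(\emptyset)$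 uses the smallest $E$-ring $\mathbb{Z}^E$ of $K$; it is a subfield of $K$ on which $E$ restricts to an exponential. *)

(* Defs.v *)
From HB Require Import structures.
From mathcomp Require Import all_boot all_order all_algebra.
From mathcomp Require Import all_classical all_reals all_analysis.
Set Implicit Arguments.
Unset Strict Implicit.
Unset Printing Implicit Defensive.
Import Order.TTheory GRing.Theory Num.Theory numFieldNormedType.Exports.
Local Open Scope classical_set_scope.
Local Open Scope ring_scope.

(* First-order syntax of L_exp = {+, -, *, 0, 1, <, E}. Variables are
   de Bruijn indices: [Var 0] refers to the innermost quantifier. *)
Inductive term : Type :=
  | Var of nat
  | Zero
  | One
  | Add of term & term
  | Opp of term
  | Mul of term & term
  | Exp of term.

Inductive formula : Type :=
  | Eq of term & term
  | Lt of term & term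
  | Not of formula
  | And of formula & formula
  | Or of formula & formula
  | Imp of formula & formula
  | Ex of formula
  | All of formula.

Fixpoint term_closed (n : nat) (t : term) : bool :=
  match t with
  | Var i => (i < n)%N
  | Zero | One => true
  | Add t1 t2 | Mul t1 t2 => term_closed n t1 && term_closed n t2
  | Opp t1 | Exp t1 => term_closed n t1
  end.

(* All free variables of [f] have index less than [n]. *)
Fixpoint formula_closed (n : nat) (f : formula) : bool :=
  match f with
  | Eq t1 t2 | Lt t1 t2 => term_closed n t1 && term_closed n t2
  | Not g => formula_closed n g
  | And g h | Or g h | Imp g h => formula_closed n g && formula_closed n h
  | Ex g | All g => formula_closed n.+1 g
  end.

Definition sentence (f : formula) : bool := formula_closed 0 f.

Fixpoint quantifier_free (f : formula) : bool :=
  match f with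
  | Eq _ _ | Lt _ _ => true
  | Not g => quantifier_free g
  | And g h | Or g h | Imp g h => quantifier_free g && quantifier_free h
  | Ex _ | All _ => false
  end.

Fixpoint existential (f : formula) : bool :=
  if f is Ex g then existential g else quantifier_free f.

Definition scons (T : Type) (x : T) (e : nat -> T) (i : nat) : T :=
  if i is j.+1 then e j else x.

Section Semantics.
Variables (K : realFieldType) (E : K -> K).

Fixpoint eval (e : nat -> K) (t : term) : K :=
  match t with
  | Var i => e i
  | Zero => 0
  | One => 1
  | Add t1 t2 => eval e t1 + eval e t2
  | Opp t1 => - eval e t1
  | Mul t1 t2 => eval e t1 * eval e t2
  | Exp t1 => E (eval e t1)
  end.

Fixpoint sat (e : nat -> K) (f : formula) : Prop :=
  match f with
  | Eq t1 t2 => eval e t1 = eval e t2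
  | Lt t1 t2 => eval e t1 < eval e t2
  | Not g => ~ sat e g
  | And g h => sat e g /\ sat e h
  | Or g h => sat e g \/ sat e h
  | Imp g h => sat e g -> sat e h
  | Ex g => exists x : K, sat (scons x e) g
  | All g => forall x : K, sat (scons x e) g
  end.

Definition models (f : formula) : Prop := forall e : nat -> K, sat e f.

(* The environment [e] supplies the parameters. *)
Definition definable (S : set K) : Prop :=
  exists (f : formula) (e : nat -> K), S = [set x | sat (scons x e) f].

End Semantics.

Definition existential_theory (K : realFieldType) (E : K -> K) : set formula :=
  [set f | [/\ sentence f, existential f & models E f]].

(* ]a, b[ with a in K or a = -oo, and b in K or b = +oo; [BSide false] is an
   open left bound and [BSide true] an open right bound. *)
Definition open_interval (K : realFieldType) (I : interval K) : bool :=
  match I with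
  | Interval (BSide false _ | -oo%O) (BSide true _ | +oo%O) => true
  | _ => false
  end.

Definition o_minimal (K : realFieldType) (E : K -> K) : Prop :=
  forall S : set K, definable E S ->
  exists (pts : seq K) (itvs : seq (interval K)),
    all (@open_interval K) itvs /\
    S = [set x | x \in pts \/ exists2 I, I \in itvs & x \in I].

Record ordered_exponential (K : realFieldType) (E : K -> K) : Prop := {
  expD : forall x y, E (x + y) = E x * E y;
  exp0 : E 0 = 1;
  exp_lt : forall x y, (E x < E y) = (x < y);
  exp_gt0 : forall x, 0 < E x;
  exp_onto : forall y, 0 < y -> exists x, E x = y }.

(* [is_derive] is taken in the order topology of K, so that the second
   condition is the usual epsilon-delta sentence for E' = E. *)
Definition EXP_field (K : realFieldType) (E : K -> K) : Prop :=
  ordered_exponential E /\ forall x : K, is_derive x 1 E (E x).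

Definition is_Ering (R : pzRingType) (E : R -> R) (A : set R) : Prop :=
  [/\ A 1,
      forall x y, A x -> A y -> A (x - y),
      forall x y, A x -> A y -> A (x * y)
    & forall x, A x -> A (E x)].

Section ExponentialClosure.
Variables (K : realFieldType) (E : K -> K).

(* A[x_1, ..., x_n]^E as a ring of functions K^n -> K, on which E acts by
   composition; a ring contains A[x_1, ..., x_n] as soon as it contains the
   constants from A and the coordinate functions. *)
Definition exp_poly (A : set K) (n : nat) : set ('rV[K]_n -> K) :=
  smallest (is_Ering (fun f : 'rV[K]_n -> K => E \o f))
    ([set cst a | a in A] `|`
     [set (fun v : 'rV[K]_n => v 0 j) | j in [set: 'I_n]]).

(* In an EXP-field the functions in [exp_poly] are differentiable, hence the
   entries are genuine partial derivatives, not default values of [lim]. *)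
Definition jacobian_mx (n : nat) (f : 'I_n.+1 -> 'rV[K]_n.+1 -> K)
    (a : 'rV[K]_n.+1) : 'M[K]_n.+1 :=
  \matrix_(i, j) 'D_(delta_mx 0 j) (f i) a.

Definition khovanskii_solution (n : nat) (f : 'I_n.+1 -> 'rV[K]_n.+1 -> K)
    (a : 'rV[K]_n.+1) : Prop :=
  (forall i, f i a = 0) /\ \det (jacobian_mx f a) != 0.

Definition ecl (B : set K) : set K :=
  [set a1 | exists (n : nat) (f : 'I_n.+1 -> 'rV[K]_n.+1 -> K)
                   (a : 'rV[K]_n.+1),
     [/\ forall i, exp_poly (smallest (is_Ering E) B) (f i),
         khovanskii_solution f a
       & a 0 0 = a1]].

End ExponentialClosure.

(* [phi] is only relevant on the substructure [A] of (K1, E1). *)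
Record Lexp_embedding (K1 K2 : realFieldType) (E1 : K1 -> K1) (E2 : K2 -> K2)
    (A : set K1) (phi : K1 -> K2) : Prop := {
  emb0 : phi 0 = 0;
  emb1 : phi 1 = 1;
  embD : forall x y, A x -> A y -> phi (x + y) = phi x + phi y;
  embN : forall x, A x -> phi (- x) = - phi x;
  embM : forall x y, A x -> A y -> phi (x * y) = phi x * phi y;
  embE : forall x, A x -> phi (E1 x) = E2 (phi x);
  emb_inj : forall x y, A x -> A y -> phi x = phi y -> x = y;
  emb_lt : forall x y, A x -> A y -> (phi x < phi y) = (x < y) }.

(* Main.v *)
Require Import Defs.
From HB Require Import structures.
From mathcomp Require Import all_boot all_order all_algebra perm.
From mathcomp Require Import all_classical all_reals all_analysis.
From mathcomp Require Import lra.
Set Implicit Arguments.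
Unset Strict Implicit.
Unset Printing Implicit Defensive.
Import Order.TTheory GRing.Theory Num.Theory numFieldNormedType.Exports.
(* [eval] would otherwise denote the constant of [all_analysis]. *)
Import Defs.
Local Open Scope classical_set_scope.
Local Open Scope ring_scope.

(** An element [z] of [K1] is coded if some quantifier-free formula holds at a
    tuple of [K1] with first entry [z], while in [K2] only finitely many first
    entries occur among its solutions.  Existential sentences transfer from
    [K1] to [K2], so each finite set of elements of [K1] has a partial embedding
    into [K2] respecting the coding formulas; a coded element has only finitely
    many possible images, hence the partial embeddings converge along an
    ultrafilter to an embedding of the coded elements.

    Elements of [ecl E1 set0] are coded by their Khovanskii systems.  A solution
    of such a system in [K2] is isolated because the Jacobian is invertible, and
    a definable set [V] of isolated points projects to a finite set: otherwise
    the projection contains an interval, by o-minimality the points over some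
    subinterval have a common isolation radius and a common bound, and these
    points then accumulate, which contradicts the common radius. *)

(** * Renaming and existential closure *)

Fixpoint trename (s : nat -> nat) (t : term) : term :=
  match t with
  | Var i => Var (s i)
  | Zero => Zero
  | One => One
  | Add t1 t2 => Add (trename s t1) (trename s t2)
  | Opp t1 => Opp (trename s t1)
  | Mul t1 t2 => Mul (trename s t1) (trename s t2)
  | Exp t1 => Exp (trename s t1)
  end.

Definition lift_ren (s : nat -> nat) (i : nat) : nat :=
  if i is j.+1 then (s j).+1 else 0%N.

Fixpoint frename (s : nat -> nat) (f : formula) : formula :=
  match f with
  | Eq t1 t2 => Eq (trename s t1) (trename s t2)
  | Lt t1 t2 => Lt (trename s t1) (trename s t2)
  | Not g => Not (frename s g)
  | And g h => And (frename s g) (frename s h)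
  | Or g h => Or (frename s g) (frename s h)
  | Imp g h => Imp (frename s g) (frename s h)
  | Ex g => Ex (frename (lift_ren s) g)
  | All g => All (frename (lift_ren s) g)
  end.

Lemma qf_frename s f : quantifier_free (frename s f) = quantifier_free f.
Proof. by elim: f s => //= [g IHg h IHh|g IHg h IHh|g IHg h IHh] s; rewrite IHg IHh. Qed.

(** The environment met under [N] nested quantifiers: their witnesses fill the first [N] entries and
    the outer environment is shifted past them. *)
Definition env_cat (T : Type) (N : nat) (w e : nat -> T) (i : nat) : T :=
  if (i < N)%N then w i else e (i - N)%N.

(** The outermost of [N.+1] quantifiers binds the variable of index [N], so its witness is the first
    to be put in front of [e]. *)
Lemma env_catS (T : Type) N (w e : nat -> T) :
  env_cat N.+1 w e = env_cat N w (scons (w N) e).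
Proof.
apply/funext => i; rewrite /env_cat ltnS; case: (ltngtP i N) => [//|lt_Ni|->].
  by case: i lt_Ni => // i lt_Ni; rewrite subSS subSn.
by rewrite subnn.
Qed.

Lemma term_closed_le n m t : (n <= m)%N -> term_closed n t -> term_closed m t.
Proof.
move=> nm; elim: t => //= [i /leq_trans->//||]t1 IH1 t2 IH2 /andP[/IH1-> /IH2->//].
Qed.

Lemma formula_closed_le n m f :
  (n <= m)%N -> formula_closed n f -> formula_closed m f.
Proof.
elim: f n m => //= [t1 t2|t1 t2|g IHg h IHh|g IHg h IHh|g IHg h IHh|g IHg|g IHg] n m nm.
- by move=> /andP[]; do 2 move=> /(term_closed_le nm)->.
- by move=> /andP[]; do 2 move=> /(term_closed_le nm)->.
- by move=> /andP[/(IHg _ _ nm)-> /(IHh _ _ nm)->].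
- by move=> /andP[/(IHg _ _ nm)-> /(IHh _ _ nm)->].
- by move=> /andP[/(IHg _ _ nm)-> /(IHh _ _ nm)->].
- exact: IHg.
- exact: IHg.
Qed.

Lemma term_closed_ex t : exists n, term_closed n t.
Proof.
elim: t => /= [i|||t1 [n IH1] t2 [m IH2]|//|t1 [n IH1] t2 [m IH2]|//];
  try by [exists i.+1 | exists 0%N];
  by exists (maxn n m); rewrite (term_closed_le (leq_maxl _ _) IH1)
    (term_closed_le (leq_maxr _ _) IH2).
Qed.

Lemma formula_closed_ex f : exists n, formula_closed n f.
Proof.
have tt t1 t2 : exists n, term_closed n t1 && term_closed n t2.
  exact: (term_closed_ex (Add t1 t2)).
elim: f => //= [g [n IHg] h [m IHh]|g [n IHg] h [m IHh]|g [n IHg] h [m IHh]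
  |g [n IHg]|g [n IHg]];
  try by exists (maxn n m); rewrite (formula_closed_le (leq_maxl _ _) IHg)
    (formula_closed_le (leq_maxr _ _) IHh).
all: by exists n; apply: formula_closed_le IHg.
Qed.

Lemma formula_closed_iterEx m n f :
  formula_closed m (iter n Ex f) = formula_closed (m + n) f.
Proof. by elim: n m => [|n IHn] m; rewrite ?addn0 //= IHn addSnnS. Qed.

Lemma existential_iterEx n f : quantifier_free f -> existential (iter n Ex f).
Proof. by move=> qf; elim: n => //=; case: f qf. Qed.

Lemma qf_And f g : quantifier_free f -> quantifier_free g -> quantifier_free (And f g).
Proof. by move=> /= -> ->. Qed.

Definition conj (k : nat) (F : nat -> formula) : formula :=
  foldr (fun i => And (F i)) (Eq Zero Zero) (iota 0 k).

Lemma qf_conj k F : (forall i, quantifier_free (F i)) -> quantifier_free (conj k F).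
Proof. by move=> qF; rewrite /conj; elim: (iota 0 k) => //= i s ->; rewrite qF. Qed.

(** * Satisfaction under renaming, change of environment and iterated quantification *)

Section Satisfaction.
Variables (K : realFieldType) (E : K -> K).
Implicit Types (e w : nat -> K) (t : term) (f : formula).

Lemma eval_rename e s t : eval E e (trename s t) = eval E (e \o s) t.
Proof. by elim: t => //= [t1 -> t2 ->|t1 ->|t1 -> t2 ->|t1 ->]. Qed.

Lemma sat_rename e s f : sat E e (frename s f) = sat E (e \o s) f.
Proof.
have sl x e' s' : scons x e' \o lift_ren s' = scons x (e' \o s').
  by apply/funext; case.
elim: f e s => //= [t1 t2|t1 t2|g IHg|g IHg h IHh|g IHg h IHh|g IHg h IHh|g IHg|g IHg] e s;
  rewrite ?eval_rename ?IHg ?IHh //.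
- by apply: eq_exists => x; rewrite IHg sl.
- by apply: eq_forall => x; rewrite IHg sl.
Qed.

Lemma eval_closed n e e' t : (forall i, (i < n)%N -> e i = e' i) ->
  term_closed n t -> eval E e t = eval E e' t.
Proof.
move=> ee; elim: t => //= [t1 IH1 t2 IH2|t1 IH1|t1 IH1 t2 IH2|t1 IH1].
- by move=> /andP[/IH1-> /IH2->].
- by move=> /IH1->.
- by move=> /andP[/IH1-> /IH2->].
- by move=> /IH1->.
Qed.

Lemma sat_closed n e e' f : (forall i, (i < n)%N -> e i = e' i) ->
  formula_closed n f -> sat E e f = sat E e' f.
Proof.
elim: f n e e' => //= [t1 t2|t1 t2|g IHg|g IHg h IHh|g IHg h IHh|g IHg h IHh|g IHg|g IHg] n e e' ee.
- by move=> /andP[c1 c2]; rewrite (eval_closed ee c1) (eval_closed ee c2).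
- by move=> /andP[c1 c2]; rewrite (eval_closed ee c1) (eval_closed ee c2).
- by move=> /(IHg _ _ _ ee)->.
- by move=> /andP[/(IHg _ _ _ ee)-> /(IHh _ _ _ ee)->].
- by move=> /andP[/(IHg _ _ _ ee)-> /(IHh _ _ _ ee)->].
- by move=> /andP[/(IHg _ _ _ ee)-> /(IHh _ _ _ ee)->].
- move=> cg; apply: eq_exists => x.
  by apply: IHg cg; case=> //= i /ee.
- move=> cg; apply: eq_forall => x.
  by apply: IHg cg; case=> //= i /ee.
Qed.

Lemma sat_iterEx N e f :
  sat E e (iter N Ex f) <-> exists w, sat E (env_cat N w e) f.
Proof.
elim: N e => [|N IHN] e /=.
  have e0 w : env_cat 0 w e = e by apply/funext => i; rewrite /env_cat subn0.
  by split=> [h|[w]]; [exists e|]; rewrite e0.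
split=> [[x /IHN[w hw]]|[w]].
  exists (fun i => if (i < N)%N then w i else x).
  rewrite env_catS ltnn; congr (sat E _ f): hw.
  by apply/funext => i; rewrite /env_cat; case: ifP.
by rewrite env_catS => hw; exists (w N); apply/IHN; exists w.
Qed.

Lemma sat_And e f g : sat E e (And f g) <-> sat E e f /\ sat E e g.
Proof. by []. Qed.

Lemma sat_conj e k F : sat E e (conj k F) <-> forall i, (i < k)%N -> sat E e (F i).
Proof.
have -> : (forall i, (i < k)%N -> sat E e (F i)) <->
    forall i, i \in iota 0 k -> sat E e (F i).
  by split=> h i; [rewrite mem_iota add0n|move=> ik; apply: h; rewrite mem_iota add0n]; auto.
rewrite /conj; elim: (iota 0 k) => //= j s IHs; split=> [[hj /IHs hs] i|h].
  by rewrite inE => /predU1P[->//|/hs].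
by split; [apply: h; rewrite mem_head|apply/IHs => i si; apply: h; rewrite inE si orbT].
Qed.

End Satisfaction.

(** * Coded elements and the ultrafilter limit *)

Section Transfer.
Variables (K1 K2 : realFieldType) (E1 : K1 -> K1) (E2 : K2 -> K2).
Hypothesis hth : forall f : formula, existential_theory E1 f -> models E2 f.

(** Only finitely many variables occur in [f]; quantifying all of them existentially gives a
    sentence that [w] makes true in [K1]. *)
Lemma qf_transfer (f : formula) (w : nat -> K1) :
  quantifier_free f -> sat E1 w f -> exists w' : nat -> K2, sat E2 w' f.
Proof.
move=> qf wf; have [n cf] := formula_closed_ex f.
have : models E2 (iter n Ex f).
  apply: hth; split.
  - by rewrite /sentence formula_closed_iterEx add0n.
  - exact: existential_iterEx.
  - move=> e; apply/sat_iterEx; exists w.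
    rewrite (@sat_closed _ E1 n _ w)// => i i_n.
    by rewrite /env_cat i_n.
by move=> /(_ (fun=> 0))/sat_iterEx[w' hw']; exists (env_cat n w' (fun=> 0)).
Qed.

Definition coded (z : K1) : Prop :=
  exists (f : formula) (w : nat -> K1) (s : seq K2),
    [/\ quantifier_free f, sat E1 w f, w 0%N = z
      & forall w', sat E2 w' f -> w' 0%N \in s].

(** Codes of [x] and [y] on disjoint variables are joined to an equation for the value of [t]; in
    [K2] that value then comes from one of finitely many pairs. It makes sums, products and
    exponentials of coded elements coded. *)
Lemma coded_eval (t : term) (x y : K1) :
  coded x -> coded y -> coded (eval E1 (scons x (fun=> y)) t).
Proof.
move=> [f [wf [sf [qf hf <- Cf]]]] [g [wg [sg [qg hg <- Cg]]]].
(* Entry [0] holds the value of [t], the odd entries hold [wf], and the positive even ones hold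
   [wg]; hence [v] sends the variables of [t] to the entries [1] and [2]. *)
pose w m := if m is m'.+1 then if odd m' then wg m'./2 else wf m'./2
  else eval E1 (scons (wf 0%N) (fun=> wg 0%N)) t.
pose v i := if i is 0 then 1%N else 2%N.
exists (And (Eq (Var 0) (trename v t))
  (And (frename (fun j => j.*2.+1) f) (frename (fun j => j.*2.+2) g))), w,
  [seq eval E2 (scons a (fun=> b)) t | a <- sf, b <- sg].
split => //=.
- by rewrite !qf_frename qf.
- rewrite !sat_rename eval_rename; split.
    by congr eval; apply/funext; case.
  split; [congr (sat E1 _ f): hf|congr (sat E1 _ g): hg];
    by apply/funext => j; rewrite /= ?odd_double ?doubleK ?uphalf_double.
- move=> w'; rewrite !sat_rename eval_rename => -[-> [/Cf/= a_in /Cg/= b_in]].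
  apply/allpairsP; exists (w' 1%N, w' 2%N); split => //=.
  by congr eval; apply/funext; case.
Qed.

(** The constants, the graphs of the operations and the order, in at most three variables: being an
    embedding amounts to respecting these finitely many formulas at triples. *)
Definition atoms : seq formula :=
  [:: Eq (Var 0) Zero; Eq (Var 0) One; Eq (Var 2) (Add (Var 0) (Var 1));
      Eq (Var 1) (Opp (Var 0)); Eq (Var 2) (Mul (Var 0) (Var 1));
      Eq (Var 1) (Exp (Var 0)); Lt (Var 0) (Var 1)].

Definition atom (m : nat) : formula := nth (Eq Zero Zero) atoms m.

Lemma qf_atom m : quantifier_free (atom m).
Proof. by do 7 (case: m => [//|m]); rewrite /atom nth_default. Qed.

Definition triple (T : Type) (x y z : T) : nat -> T := scons x (scons y (fun=> z)).

Lemma triple_comp (T U : Type) (h : T -> U) (x y z : T) :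
  h \o triple x y z = triple (h x) (h y) (h z).
Proof. by apply/funext => -[|[]]. Qed.

(** The codes of the points in [zs] and the truth values of all atoms at all their triples form a
    single quantifier-free formula; [psi] is read off a solution of it in [K2]. *)
Lemma partial_embedding (th : K1 -> formula) (wt : K1 -> nat -> K1)
    (n : nat) (zs : seq K1) :
  (forall z, [/\ quantifier_free (th z), sat E1 (wt z) (th z) & wt z 0%N = z]) ->
  exists psi : K1 -> K2,
    {in zs, forall z, exists2 w, sat E2 w (th z) & w 0%N = psi z} /\
    {in zs & &, forall x y z, forall m, (m < n)%N ->
      sat E1 (triple x y z) (atom m) <->
      sat E2 (triple (psi x) (psi y) (psi z)) (atom m)}.
Proof.
move=> thP; pose k := size zs; pose zn := nth 0 zs.
(* Variable [pickle (i, j)] stands for entry [j] of the witness of the [i]-th point, which keeps the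
   witnesses apart; [v i] is the variable of the point itself. *)
pose w m := if @unpickle (nat * nat)%type m is Some (i, j) then wt (zn i) j else 0.
pose v i := @pickle (nat * nat)%type (i, 0%N).
(* Transferring whichever of [a] and its negation holds in [K1] yields an equivalence rather than an
   implication. *)
pose lit a := if `[< sat E1 w a >] then a else Not a.
have lit_qf a : quantifier_free a -> quantifier_free (lit a).
  by rewrite /lit; case: ifP.
have lit1 a : sat E1 w (lit a).
  by rewrite /lit; case: asboolP.
have lit2 a w' : sat E2 w' (lit a) -> (sat E1 w a <-> sat E2 w' a).
  by rewrite /lit; case: asboolP => //= *; split.
have wv i : w (v i) = zn i by rewrite /w /v pickleK; have [_ _ ->] := thP (zn i).
pose F := And (conj k (fun i => frename (fun j => pickle (i, j)) (th (zn i))))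
  (conj n (fun m => conj k (fun i => conj k (fun j => conj k (fun l =>
     lit (frename (triple (v i) (v j) (v l)) (atom m))))))).
have [||w' [hth' hat]] := @qf_transfer F w.
- apply: qf_And.
    by apply: qf_conj => i; rewrite qf_frename; have [] := thP (zn i).
  by do 4 (apply: qf_conj => ?); apply: lit_qf; rewrite qf_frename qf_atom.
- split; last by do 4 (apply/sat_conj => ? _); exact: lit1.
  apply/sat_conj => i _; rewrite sat_rename; have [_ + _] := thP (zn i).
  by congr (sat E1 _ _); apply/funext => j; rewrite /= /w pickleK.
have zK x : x \in zs -> zn (index x zs) = x by move=> xs; rewrite /zn nth_index.
exists (fun x => w' (v (index x zs))); split=> [z zzs|x y z xs ys zs' m mn].
  move/sat_conj: hth' => /(_ (index z zs)); rewrite index_mem => /(_ zzs).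
  by rewrite sat_rename zK// => ?; eexists; first by eassumption.
move/sat_conj: hat => /(_ m mn)/sat_conj/(_ (index x zs)); rewrite index_mem.
move=> /(_ xs)/sat_conj/(_ (index y zs)); rewrite index_mem.
move=> /(_ ys)/sat_conj/(_ (index z zs)); rewrite index_mem.
move=> /(_ zs') hl; have := lit2 _ _ hl; rewrite !sat_rename !triple_comp !wv.
by rewrite !zK.
Qed.

Lemma ultra_pigeonhole (T : Type) (U : eqType) (G : set_system T)
    (h : T -> U) (s : seq U) : UltraFilter G ->
  (\forall x \near G, h x \in s) -> exists c, \forall x \near G, h x = c.
Proof.
move=> UG; elim: s => [|c s IHs] hs.
  by have /filter_ex[x] := hs.
have [hc|hc] := in_ultra_setVsetC [set x | h x = c] UG; first by exists c.
apply: IHs; apply: filterS2 hs hc => x.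
by rewrite inE => /predU1P[].
Qed.

Lemma coded_embedding (A : set K1) :
  (forall z, A z -> coded z) -> exists phi : K1 -> K2, Lexp_embedding E1 E2 A phi.
Proof.
move=> Acoded.
(* Elements that are not coded get the valid formula [Eq Zero Zero], so that [partial_embedding]
   applies to arbitrary lists. *)
have /choice[thw thwP] z : exists p : formula * (nat -> K1),
    [/\ quantifier_free p.1, sat E1 p.2 p.1, p.2 0%N = z &
     coded z -> exists s : seq K2, forall w', sat E2 w' p.1 -> w' 0%N \in s].
  have [[f [w [s [qf hf wz hs]]]]|nc] := pselect (coded z).
    by exists (f, w); split=> // _; exists s.
  by exists (Eq Zero Zero, fun=> z); split.
have /choice[psi psiP] zs :=
  @partial_embedding (fun z => (thw z).1) (fun z => (thw z).2) 7 zs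
    (fun z => let: And4 a b c _ := thwP z in And3 a b c).
(* Lists are directed by inclusion; along an ultrafilter refining [B], every element of [K1]
   eventually belongs to the list. *)
pose B := filter_from [set: seq K1] (fun s => [set zs : seq K1 | {subset s <= zs}]).
have BF : ProperFilter B.
  apply: filter_from_proper; last by move=> s _; exists s.
  apply: filter_from_filter; first by exists [::].
  move=> s1 s2 _ _; exists (s1 ++ s2) => // zs hzs.
  by split=> x xs; apply: hzs; rewrite mem_cat xs ?orbT.
have [G [UG BG]] := ultraFilterLemma BF.
have near_mem x : \forall zs \near G, x \in zs.
  apply: BG; exists [:: x] => // zs; apply; exact: mem_head.
have /choice[phi phiP] x : exists y, coded x -> \forall zs \near G, psi zs x = y.
  have [cx|ncx] := pselect (coded x); last by exists 0.
  have [_ _ _ /(_ cx)[s hs]] := thwP x.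
  have [|y hy] := @ultra_pigeonhole _ _ G (psi^~ x) s UG; last by exists y.
  near=> zs; have [+ _] := psiP zs.
  by move=> /(_ x (near (near_mem x) zs _))[//|w /hs + <-].
have phi_atom m x y z : (m < 7)%N -> coded x -> coded y -> coded z ->
    sat E1 (triple x y z) (atom m) <->
    sat E2 (triple (phi x) (phi y) (phi z)) (atom m).
  (* Finitely many members of the ultrafilter meet, so some list contains the three points and its
     [psi] agrees with [phi] at them. *)
  move=> m7 cx cy cz; have [zs [xs ys zs' [<- <- <-]]] : exists zs,
     [/\ x \in zs, y \in zs, z \in zs & [/\ psi zs x = phi x, psi zs y = phi y & psi zs z = phi z]].
    have := filter_ex (filterI (filterI (near_mem x) (filterI (near_mem y) (near_mem z)))
      (filterI (phiP x cx) (filterI (phiP y cy) (phiP z cz)))).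
    by move=> [zs [[? [? ?]] [? [? ?]]]]; exists zs.
  by have [_ +] := psiP zs; apply.
have c0 : coded 0.
  by exists (Eq (Var 0) Zero), (fun=> 0), [:: 0]; split=> //= w' ->; rewrite mem_head.
have c1 : coded 1.
  by exists (Eq (Var 0) One), (fun=> 1), [:: 1]; split=> //= w' ->; rewrite mem_head.
have lt_phi x y : A x -> A y -> (phi x < phi y) = (x < y).
  move=> /Acoded cx /Acoded cy; apply/idP/idP => h;
  by apply/(phi_atom 6%N x y 0).
exists phi; split => //.
- by apply/(phi_atom 0%N 0 0 0).
- by apply/(phi_atom 1%N 1 0 0).
- move=> x y /Acoded cx /Acoded cy; apply/(phi_atom 2%N x y (x + y)) => //.
  exact: (coded_eval (Add (Var 0) (Var 1)) cx cy).
- move=> x /Acoded cx; apply/(phi_atom 3%N x (- x) 0) => //.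
  exact: (coded_eval (Opp (Var 0)) cx cx).
- move=> x y /Acoded cx /Acoded cy; apply/(phi_atom 4%N x y (x * y)) => //.
  exact: (coded_eval (Mul (Var 0) (Var 1)) cx cy).
- move=> x /Acoded cx; apply/(phi_atom 5%N x (E1 x) 0) => //.
  exact: (coded_eval (Exp (Var 0)) cx cx).
- by move=> x y Ax Ay xy; have [||//] := ltgtP x y; rewrite -lt_phi// xy ltxx.
Unshelve. all: by end_near. Qed.

End Transfer.

(** * Definable sets in o-minimal structures *)

Section Definability.
Variables (K : realFieldType) (E : K -> K).

(** No parameters occur here: they enter later as entries of the environment, through
    [def_pred_definable]. Definability can thus be proved by following the shape of the
    predicate. *)
Definition def_pred (P : (nat -> K) -> Prop) : Prop :=
  exists f, forall e, P e <-> sat E e f.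

Definition def_fun (h : (nat -> K) -> K) : Prop :=
  exists t, forall e, h e = eval E e t.

Lemma def_fun_var i : def_fun (fun e => e i).
Proof. by exists (Var i). Qed.

Lemma def_fun0 : def_fun (fun=> 0).
Proof. by exists Zero. Qed.

Lemma def_fun1 : def_fun (fun=> 1).
Proof. by exists One. Qed.

Lemma def_funN h : def_fun h -> def_fun (fun e => - h e).
Proof. by move=> [t ht]; exists (Opp t) => e; rewrite ht. Qed.

Lemma def_funD g h : def_fun g -> def_fun h -> def_fun (fun e => g e + h e).
Proof. by move=> [s hs] [t ht]; exists (Add s t) => e; rewrite hs ht. Qed.

Lemma def_funM g h : def_fun g -> def_fun h -> def_fun (fun e => g e * h e).
Proof. by move=> [s hs] [t ht]; exists (Mul s t) => e; rewrite hs ht. Qed.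

Lemma def_eq g h : def_fun g -> def_fun h -> def_pred (fun e => g e = h e).
Proof. by move=> [s hs] [t ht]; exists (Eq s t) => e; rewrite hs ht. Qed.

Lemma def_lt g h : def_fun g -> def_fun h -> def_pred (fun e => g e < h e).
Proof. by move=> [s hs] [t ht]; exists (Lt s t) => e; rewrite hs ht. Qed.

Lemma def_ext P Q : (forall e, P e <-> Q e) -> def_pred Q -> def_pred P.
Proof. by move=> PQ [f hf]; exists f => e; rewrite PQ. Qed.

Lemma def_not P : def_pred P -> def_pred (fun e => ~ P e).
Proof. by move=> [f hf]; exists (Not f) => e; rewrite /= hf. Qed.

Lemma def_and P Q : def_pred P -> def_pred Q -> def_pred (fun e => P e /\ Q e).
Proof. by move=> [f hf] [g hg]; exists (And f g) => e; rewrite /= hf hg. Qed.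

Lemma def_imp P Q : def_pred P -> def_pred Q -> def_pred (fun e => P e -> Q e).
Proof. by move=> [f hf] [g hg]; exists (Imp f g) => e; rewrite /= hf hg. Qed.

Lemma def_le g h : def_fun g -> def_fun h -> def_pred (fun e => g e <= h e).
Proof.
move=> dg dh; apply: (def_ext (Q := fun e => ~ h e < g e)); last exact/def_not/def_lt.
by move=> e; rewrite leNgt; split=> [/negP|/negP].
Qed.

Lemma def_norm_lt g h :
  def_fun g -> def_fun h -> def_pred (fun e => `|g e| < h e).
Proof.
move=> dg dh; apply: (def_ext (Q := fun e => - h e < g e /\ g e < h e)).
  by move=> e; rewrite ltr_norml; split=> /andP.
by apply: def_and; apply: def_lt => //; exact: def_funN.
Qed.

Lemma def_norm_le g h :
  def_fun g -> def_fun h -> def_pred (fun e => `|g e| <= h e).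
Proof.
move=> dg dh; apply: (def_ext (Q := fun e => - h e <= g e /\ g e <= h e)).
  by move=> e; rewrite ler_norml; split=> /andP.
by apply: def_and; apply: def_le => //; exact: def_funN.
Qed.

Lemma def_ren (s : nat -> nat) P : def_pred P -> def_pred (fun e => P (e \o s)).
Proof. by move=> [f hf]; exists (frename s f) => e; rewrite sat_rename. Qed.

Lemma def_ex (P : K -> (nat -> K) -> Prop) :
  def_pred (fun e => P (e 0%N) (e \o S)) -> def_pred (fun e => exists x, P x e).
Proof.
move=> [f hf]; exists (Ex f) => e /=.
by split=> -[x hx]; exists x; apply/(hf (scons x e)).
Qed.

Lemma def_all (P : K -> (nat -> K) -> Prop) :
  def_pred (fun e => P (e 0%N) (e \o S)) -> def_pred (fun e => forall x, P x e).
Proof.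
move=> [f hf]; exists (All f) => e /=.
by split=> hx x; apply/(hf (scons x e)); exact: hx.
Qed.

(** Since [P] reads only the first [N] entries of [w], quantifying over the infinite sequence [w]
    amounts to [N] first-order quantifiers. *)
Lemma def_exN N (P : (nat -> K) -> (nat -> K) -> Prop) :
  (forall w w' e, (forall i, (i < N)%N -> w i = w' i) -> P w e -> P w' e) ->
  def_pred (fun e => P e (fun i => e (N + i)%N)) ->
  def_pred (fun e => exists w, P w e).
Proof.
move=> Pext [f hf]; exists (iter N Ex f) => e; rewrite sat_iterEx.
have catE w : (fun i => env_cat N w e (N + i)%N) = e.
  by apply/funext => i; rewrite /env_cat ltnNge leq_addr addKn.
have lowE w i : (i < N)%N -> w i = env_cat N w e i by rewrite /env_cat => ->.
split=> -[w hw]; exists w.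
  by apply/hf; rewrite catE; apply: Pext hw => i /lowE.
by move/hf: hw; rewrite catE; apply: Pext => i /lowE/esym.
Qed.

Lemma def_allN N (P : (nat -> K) -> (nat -> K) -> Prop) :
  (forall w w' e, (forall i, (i < N)%N -> w i = w' i) -> P w e -> P w' e) ->
  def_pred (fun e => P e (fun i => e (N + i)%N)) ->
  def_pred (fun e => forall w, P w e).
Proof.
move=> Pext dP; apply: (def_ext (Q := fun e => ~ exists w, ~ P w e)).
  move=> e; split=> [h [w]|h w]; first by apply; exact: h.
  by apply: contrapT => nP; apply: h; exists w.
apply: def_not; apply: (def_exN (N := N)); last exact: def_not.
move=> w w' e ww'; apply: contra_not; apply: Pext => i /ww' //.
Qed.

Lemma def_bounded_all N (P : nat -> (nat -> K) -> Prop) :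
  (forall i, (i < N)%N -> def_pred (P i)) ->
  def_pred (fun e => forall i, (i < N)%N -> P i e).
Proof.
elim: N => [|N IHN] dP; first by exists (Eq Zero Zero).
apply: (def_ext (Q := fun e => (forall i, (i < N)%N -> P i e) /\ P N e)).
  move=> e; split=> [h|[h hN] i]; first by split=> [i iN|]; apply: h => //; exact: ltnW.
  by rewrite ltnS leq_eqVlt => /predU1P[->|/h].
by apply: def_and; [apply: IHN => i iN; apply: dP; exact: ltnW|exact: dP].
Qed.

Lemma def_pred_definable P e : def_pred P -> definable E [set x | P (scons x e)].
Proof.
move=> [f hf]; exists f, e; apply/seteqP; split=> x /=; by rewrite hf.
Qed.

End Definability.

(** * One-variable consequences of o-minimality *)

Section OMinimal.
Variables (K : realFieldType) (E : K -> K).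
Hypothesis om : o_minimal E.

(** If some interval of the decomposition is nonempty, it contains a bounded one with endpoints in
    [K]; otherwise only the isolated points of the decomposition remain. *)
Lemma definable_finite_or_interval (S : set K) : definable E S ->
  (exists s : seq K, forall x, S x -> x \in s) \/
  (exists c d, c < d /\ forall x, c < x < d -> S x).
Proof.
move=> /om[pts [itvs [ho ->]]].
have [[x [I Ii xI]]|none] := pselect (exists x, exists2 I, I \in itvs & x \in I).
  right; move/allP: ho => /(_ I Ii) oI.
  have [c [d [cd cdI]]] : exists c d, c < d /\ forall x, c < x < d -> x \in I.
    case: I xI oI {Ii} => -[[//|]a|[|//]] [[|//]b|[//|]]; rewrite !in_itv/= => xI _.
    - move: xI => /andP[ax xb]; exists a, b; split; first exact: lt_trans xb.
      by move=> y; rewrite in_itv.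
    - exists a, (a + 1); split=> [|y]; first by rewrite ltrDl.
      by rewrite in_itv/= andbT => /andP[].
    - exists (b - 1), b; split=> [|y]; first by rewrite ltrBlDr ltrDl.
      by rewrite in_itv/= => /andP[].
    - by exists 0, 1; split=> [|y]; rewrite ?ltr01 ?in_itv.
  by exists c, d; split=> // y /cdI yI; right; exists I.
by left; exists pts => x [//|xI]; exfalso; apply: none; exists x.
Qed.

(** This stands in for completeness of [K]: having an infimum passes to finite unions, and points
    and open intervals bounded below have one. *)
Lemma definable_glb (S : set K) (m : K) : definable E S -> S !=set0 ->
  (forall x, S x -> m <= x) ->
  exists z, (forall x, S x -> z <= x) /\ (forall u, z < u -> exists2 x, S x & x < u).
Proof.
pose glb (S : set K) :=
  exists z, (forall x, S x -> z <= x) /\ (forall u, z < u -> exists2 x, S x & x < u).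
have glbU (A B : set K) : (A !=set0 -> glb A) -> (B !=set0 -> glb B) ->
    A `|` B !=set0 -> glb (A `|` B).
  move=> gA gB; have [->|/set0P A0] := eqVneq A set0; first by rewrite set0U.
  have [->|/set0P B0] := eqVneq B set0; first by rewrite setU0.
  move=> _; have [a [lea ha]] := gA A0; have [b [leb hb]] := gB B0.
  exists (Num.min a b); split=> [x [/lea|/leb]|u].
  - by rewrite ge_min => ->.
  - by rewrite ge_min orbC => ->.
  - by rewrite gt_min => /orP[/ha[x]|/hb[x]] ? ?; exists x => //; [left|right].
move=> /om[pts [itvs [ho ->]]] S0 Sm; apply: (glbU [set x | x \in pts]
   [set x | exists2 I, I \in itvs & x \in I]) => //.
  elim: pts {S0 Sm} => [[]//|p s IHs].
  have -> : [set x | x \in p :: s] = [set p] `|` [set x | x \in s].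
    apply/seteqP; split=> x /=; rewrite inE.
      by move=> /predU1P[]; [left|right].
    by move=> [->|->]; rewrite ?eqxx ?orbT.
  apply: glbU => // _; exists p; split=> [x ->//|u pu]; by exists p.
have {S0}Sm : forall x, (exists2 I, I \in itvs & x \in I) -> m <= x.
  by move=> x h; apply: Sm; right.
elim: itvs ho Sm => [_ _ [x [I]]//|I s IHs /=/andP[oI os] Sm].
have -> : [set x | exists2 J, J \in I :: s & x \in J] =
    [set x | x \in I] `|` [set x | exists2 J, J \in s & x \in J].
  apply/seteqP; split=> x /=.
    by move=> [J]; rewrite inE => /predU1P[->|Js] xJ; [left|right; exists J].
  by move=> [xI|[J Js xJ]]; [exists I|exists J] => //; rewrite inE ?eqxx ?Js ?orbT.
apply: glbU; last first.
  apply: IHs => // x [J Js xJ]; apply: Sm; exists J => //; by rewrite inE Js orbT.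
have {}Sm x : x \in I -> m <= x by move=> xI; apply: Sm; exists I => //; rewrite mem_head.
move=> [x0 /=]; case: I oI Sm => -[[//|]a|[|//]] [[|//]b|[//|]] _ /=.
- move=> _; rewrite in_itv/= => /andP[ax0 x0b]; exists a; split=> [x|u au].
    by rewrite /= in_itv/= => /andP[/ltW].
  have au' : a < Num.min u b by rewrite lt_min au (lt_trans ax0).
  exists ((a + Num.min u b) / 2).
    rewrite /= in_itv/= midf_lt//= (lt_le_trans (_ : _ < Num.min u b))//.
      by rewrite midf_lt.
    by rewrite ge_min lexx orbT.
  by rewrite (lt_le_trans (_ : _ < Num.min u b)) ?midf_lt// ge_min lexx.
- move=> _ _; exists a; split=> [x|u au].
    by rewrite /= in_itv/= andbT => /ltW.
  by exists ((a + u) / 2); rewrite /= ?in_itv/= ?andbT midf_lt.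
(* An interval unbounded below contains a point smaller than the lower bound [m]. *)
- rewrite in_itv/= => Sm x0b; have := Sm (Num.min m b - 1).
  rewrite in_itv/=.
  have h1 : Num.min m b <= b by rewrite ge_min lexx orbT.
  have h2 : Num.min m b <= m by rewrite ge_min lexx.
  move=> /(_ ltac:(lra)) h3; lra.
- by move=> Sm _; have := Sm (m - 1); rewrite in_itv/= => /(_ isT); lra.
Qed.

Lemma seq_min (s : seq K) (P : K -> Prop) : (forall x, P x -> x \in s) ->
  (exists x, P x) -> exists2 x, P x & forall y, P y -> x <= y.
Proof.
elim: s P => [P h [x /h]//|p s IHs P Ps [x Px]].
have [[y [Py yp]]|none] := pselect (exists y, P y /\ y < p).
  have [|| z [Pz zp] zmin] := IHs (fun y => P y /\ y < p).
  - move=> z [Pz zp]; have := Ps _ Pz; rewrite inE => /predU1P[zE|//].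
    by rewrite zE ltxx in zp.
  - by exists y.
  - exists z => // u Pu; have [up|pu] := ltP u p; first exact: zmin.
    exact: le_trans (ltW zp) pu.
have [Pp|nPp] := pselect (P p).
  by exists p => // y Py; rewrite leNgt; apply/negP => yp; apply: none; exists y.
apply: IHs; last by exists x.
move=> y Py; have := Ps _ Py; rewrite inE => /predU1P[yp|//].
by rewrite yp in Py.
Qed.

(* If every fibre [P ^~ eps] were finite, the set of the minima of these fibres
   would be infinite, hence contain an interval, and one fibre would contain
   the part of that interval to the right of one of its points. *)
Lemma interval_uniform_fibre (P : K -> K -> Prop) (a b : K) :
  def_pred E (fun e => P (e 0%N) (e 1%N)) ->
  (forall t x y, 0 < y -> y <= x -> P t x -> P t y) ->
  a < b -> (forall t, a < t < b -> exists2 x, 0 < x & P t x) ->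
  exists x c d, [/\ 0 < x, c < d & forall t, c < t < d -> P t x].
Proof.
move=> dP Pmono ab Pex; apply: contrapT => none.
(* A fibre containing an interval would already be the desired conclusion. *)
have fin x : 0 < x -> exists s : seq K, forall t, a < t < b /\ P t x -> t \in s.
  move=> x0.
  have := @definable_finite_or_interval [set t | a < t < b /\ P t x].
  case=> [||[c [d [cd hcd]]]].
  - pose Q (e : nat -> K) := (e 2%N < e 0%N /\ e 0%N < e 3%N) /\ P (e 0%N) (e 1%N).
    have -> : [set t | a < t < b /\ P t x] =
        [set t | Q (scons t (scons x (scons a (scons b (fun=> 0)))))].
      by apply/seteqP; split=> t /= [/andP].
    apply: def_pred_definable; apply: def_and => //.
    by apply: def_and; apply: def_lt; apply: def_fun_var.
  - by [].
  - by exfalso; apply: none; exists x, c, d; split=> // t /hcd[].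
(* The minima of the fibres over []a, b[]. *)
pose R := [set t | a < t < b /\ exists x, [/\ 0 < x, P t x
  & forall s, a < s < t -> ~ P s x]].
have dR : definable E R.
  pose Q (e : nat -> K) := (e 1%N < e 0%N /\ e 0%N < e 2%N) /\
    exists x, (0 < x /\ P (e 0%N) x) /\ forall s, (e 1%N < s /\ s < e 0%N) -> ~ P s x.
  have -> : R = [set t | Q (scons t (scons a (scons b (fun=> 0))))].
    apply/seteqP; split=> t /=.
      move=> [/andP ab' [x [x0 Ptx hx]]]; split=> //; exists x; split=> // s /andP.
      exact: hx.
    move=> [/andP ab' [x [[x0 Ptx] hx]]]; split=> //; exists x; split=> // s /andP.
    exact: hx.
  apply: def_pred_definable; apply: def_and.
    by apply: def_and; apply: def_lt; apply: def_fun_var.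
  apply: def_ex; apply: def_and.
    apply: def_and; first by apply: def_lt; [exact: def_fun0|exact: def_fun_var].
    exact: (def_ren (fun i => if i is 0 then 1%N else 0%N) dP).
  apply: def_all; apply: def_imp.
    by apply: def_and; apply: def_lt; apply: def_fun_var.
  by apply: def_not; exact: (def_ren (fun i => i) dP).
have minR x t : 0 < x -> a < t < b -> P t x -> exists2 r, R r & r <= t.
  move=> x0 tab Ptx; have [s hs] := fin x x0.
  have [|r [rab Prx] rmin] := seq_min hs; first by exists t.
  exists r; last exact: rmin.
  split=> //; exists x; split=> // u /andP[au ur] Pux.
  have /rmin : a < u < b /\ P u x.
    by split=> //; rewrite au (lt_trans ur)//; case/andP: rab.
  by rewrite leNgt ur.
have [[s hs]|[c [d [cd hR]]]] := definable_finite_or_interval dR.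
  (* If [R] were finite with minimum [r], a fibre through the midpoint of [a] and [r] would have a
     minimum smaller than [r]. *)
  have [|r Rr rmin] := seq_min hs.
    have m_ab : a < (a + b) / 2 < b by rewrite !midf_lt.
    by have [x x0 /(minR _ _ x0 m_ab)[r]] := Pex _ m_ab; exists r.
  have /andP[ar rb] : a < r < b by case: Rr.
  have m_ab : a < (a + r) / 2 < b by rewrite midf_lt//= (lt_trans _ rb)// midf_lt.
  have [x x0 /(minR _ _ x0 m_ab)[u /rmin ru um]] := Pex _ m_ab.
  by have := le_lt_trans (le_trans ru um) (midf_lt ar).2; rewrite ltxx.
pose m := (c + d) / 2.
have cmd : c < m < d by rewrite !midf_lt.
have /andP[cm md] := cmd.
have [/andP[am mb] [x [x0 Pmx _]]] := hR m cmd.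
apply: none; exists x, m, d; split=> // t /andP[mt td].
have [|_ [y [y0 Pty ny]]] := hR t; first by rewrite td (lt_trans cm).
(* Here [t] is the minimum of the fibre at [y]. If [y <= x], that fibre would also contain the
   smaller point [m]; so [x < y], and [P t y] gives [P t x]. *)
apply: (Pmono t y x) => //.
rewrite leNgt; apply/negP => /ltW yx.
by apply: (ny m); [rewrite am mt|exact: Pmono yx Pmx].
Qed.

End OMinimal.

(** * Finite projection of definable sets of isolated points *)

Section IsolatedPoints.
Variables (K : realFieldType) (E : K -> K).
Hypothesis om : o_minimal E.
Variables (N : nat) (V : (nat -> K) -> Prop).
Hypothesis dV : def_pred E V.
Hypothesis N_gt0 : (0 < N)%N.
Hypothesis V_ext : forall w w' : nat -> K,
  (forall i, (i < N)%N -> w i = w' i) -> V w -> V w'.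

(** Only the first coordinate is required to be locally constant on [V], which is what finiteness of
    the projection needs. *)
Definition isolated (w : nat -> K) (x : K) : Prop :=
  forall w', V w' -> (forall i, (i < N)%N -> `|w' i - w i| < x) -> w' 0%N = w 0%N.

(** A single [x] is an isolation radius and, inverted, a bound on the coordinates; both conditions
    weaken as [x] decreases, as [interval_uniform_fibre] demands. The product form avoids inversion,
    which is not a symbol of the language. *)
Definition tame (w : nat -> K) (x : K) : Prop :=
  (V w /\ isolated w x) /\ forall i, (i < N)%N -> `|w i * x| <= 1.

Lemma tame_ext w w' x :
  (forall i, (i < N)%N -> w i = w' i) -> tame w x -> tame w' x.
Proof.
move=> ww' [[Vw iw] bw]; split=> [|i iN]; last by rewrite -ww' ?bw.
split; first exact: V_ext ww' Vw.
move=> u Vu hu; rewrite -(ww' 0%N)//; apply: iw => // i iN.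
by rewrite ww' ?hu.
Qed.

Lemma tame_mono w x y : 0 < y -> y <= x -> tame w x -> tame w y.
Proof.
move=> y0 yx [[Vw iw] bw]; split=> [|i iN].
  by split=> // u Vu hu; apply: iw => // i /hu/lt_le_trans; exact.
apply: le_trans (bw i iN); rewrite !normrM ler_wpM2l// !gtr0_norm//.
exact: lt_le_trans yx.
Qed.

Lemma def_tame : def_pred E (fun e => tame (fun i => e i.+1) (e 0%N)).
Proof.
apply: def_and; last first.
  apply: def_bounded_all => i _; apply: def_norm_le; last exact: def_fun1.
  by apply: def_funM; exact: def_fun_var.
apply: def_and; first exact: (def_ren S dV).
apply: (def_allN (N := N)).
  move=> w w' e ww' h Vw' hw'; rewrite -ww'//; apply: h.
    by apply: V_ext Vw' => i /ww'.
  by move=> i iN; rewrite ww' ?hw'.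
apply: def_imp => //; apply: def_imp.
  apply: def_bounded_all => i _; apply: def_norm_lt; last exact: def_fun_var.
  by apply: def_funD; [|apply: def_funN]; exact: def_fun_var.
by apply: def_eq; exact: def_fun_var.
Qed.

(* The coordinates of an accumulation point of the tame points above [c] are
   found one at a time as definable greatest lower bounds. *)
Lemma tame_accumulation (x c d : K) : 0 < x -> c < d ->
  (forall t, c < t < d -> exists2 w, tame w x & w 0%N = t) ->
  forall k, (k <= N)%N -> exists z : nat -> K, forall r, 0 < r ->
    exists w, [/\ tame w x, c < w 0%N < c + r
                & forall i, (i < k)%N -> `|w i - z i| < r].
Proof.
move=> x0 cd hcd; elim=> [_|k IHk kN].
  exists (fun=> 0) => r r0; pose m := Num.min d (c + r).
  have cm : c < m by rewrite lt_min cd ltrDl.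
  have [cm1 cm2] := midf_lt cm.
  have [|w tw w0] := hcd ((c + m) / 2).
    by rewrite cm1 (lt_le_trans cm2)// ge_min lexx.
  exists w; split=> //.
  by rewrite w0 cm1 (lt_le_trans cm2)// ge_min lexx orbT.
have [z hz] := IHk (ltnW kN).
have bnd w : tame w x -> `|w k| <= x^-1.
  move=> [_ /(_ k kN)]; rewrite normrM (gtr0_norm x0).
  by rewrite -ler_pdivlMr// div1r.
(* The infimum of [S] is the lower limit of [w k] over tame [w] as [w 0] decreases to [c] and the
   earlier coordinates tend to [z]. *)
pose S := [set u | forall r, 0 < r -> exists w, [/\ tame w x, c < w 0%N < c + r,
  forall i, (i < k)%N -> `|w i - z i| < r & w k < u]].
have dS : definable E S.
  pose Q (e : nat -> K) := forall r, 0 < r -> exists w,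
    (tame w (e 1%N) /\ (e 2%N < w 0%N /\ w 0%N < e 2%N + r)) /\
    ((forall i, (i < k)%N -> `|w i - e (3 + i)%N| < r) /\ w k < e 0%N).
  have -> : S = [set u | Q (scons u (scons x (scons c z)))].
    apply/seteqP; split=> u /= Hu r r0; have [w] := Hu r r0.
      by move=> [tw /andP hw hwz wk]; exists w.
    by move=> [[tw /andP hw] [hwz wk]]; exists w.
  apply: def_pred_definable; apply: def_all; apply: def_imp.
    by apply: def_lt; [exact: def_fun0|exact: def_fun_var].
  apply: (def_exN (N := N)).
    move=> w w' e ww' [[tw hw] [hwz wk]]; split; split.
    - exact: tame_ext tw.
    - by rewrite -ww'.
    - by move=> i ik; rewrite -ww' ?hwz// (ltn_trans ik).
    - by rewrite -ww'.
  apply: def_and; apply: def_and.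
  (* Behind the [N] entries of [w] come [r], [u] and [x], so the radius [x] sits at entry [N + 2],
     while [def_tame] expects it at entry [0]. *)
  - exact: (def_ren (fun i => if i is j.+1 then j else (N + 2)%N) def_tame).
  - apply: def_and; apply: def_lt; try exact: def_fun_var.
    by apply: def_funD; exact: def_fun_var.
  - apply: def_bounded_all => i _; apply: def_norm_lt; last exact: def_fun_var.
    by apply: def_funD; [|apply: def_funN]; exact: def_fun_var.
  - by apply: def_lt; exact: def_fun_var.
have S0 : S !=set0.
  exists (x^-1 + 1) => r r0; have [w [tw hw hwz]] := hz r r0.
  exists w; split=> //; apply: le_lt_trans (_ : x^-1 < _); last by rewrite ltrDl.
  by apply: le_trans (bnd w tw); exact: ler_norm.
have Sm u : S u -> - x^-1 <= u.
  move=> /(_ 1 ltr01)[w [tw _ _ wk]]; apply: le_trans (ltW wk).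
  by have := bnd w tw; rewrite ler_norml => /andP[].
have [y [ley hy]] := definable_glb om dS S0 Sm.
exists (fun i => if (i < k)%N then z i else y) => r r0.
(* As [y - r / 2] lies below the infimum, it is not in [S]: close enough to [c] and [z], no tame
   point has its coordinate [k] below it. An element of [S] below [y + r] gives the other side. *)
have [r1 r10 hr1] : exists2 r1, 0 < r1 & forall w, tame w x -> c < w 0%N < c + r1 ->
    (forall i, (i < k)%N -> `|w i - z i| < r1) -> y - r / 2 <= w k.
  apply: contrapT => none.
  suff /ley : S (y - r / 2) by lra.
  move=> r1 r10; apply: contrapT => nw; apply: none; exists r1 => // w tw hw hwz.
  by rewrite leNgt; apply/negP => wk; apply: nw; exists w.
have [u Su uy] : exists2 u, S u & u < y + r by apply: hy; rewrite ltrDl.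
pose r2 := Num.min r r1.
have r2r : r2 <= r by rewrite ge_min lexx.
have r2r1 : r2 <= r1 by rewrite ge_min lexx orbT.
have [|w [tw /andP[cw wc] hwz wk]] := Su r2; first by rewrite lt_min r0.
exists w; split=> //; first by rewrite cw (lt_le_trans wc)// lerD2l.
move=> i; rewrite ltnS leq_eqVlt => /predU1P[->|ik]; last first.
  by rewrite ik (lt_le_trans (hwz i ik)).
rewrite ltnn.
have := hr1 w tw; rewrite cw (lt_le_trans wc) ?lerD2l// => /(_ isT) h.
have {}h : y - r / 2 <= w k by apply: h => j jk; apply: lt_le_trans (hwz j jk) _.
by rewrite ltr_norml; apply/andP; split; lra.
Qed.

Lemma isolated_finite : (forall w, V w -> exists2 x, 0 < x & isolated w x) ->
  exists s : seq K, forall w, V w -> w 0%N \in s.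
Proof.
move=> iso; pose T := [set t | exists w, V w /\ w 0%N = t].
have [|[s hs]|[a [b [ab hab]]]] := @definable_finite_or_interval _ _ om T.
- pose Q (e : nat -> K) := exists w, V w /\ w 0%N = e 0%N.
  have -> : T = [set t | Q (scons t (fun=> 0))] by [].
  apply: def_pred_definable; apply: (def_exN (N := N)).
    by move=> w w' e ww' [/(V_ext ww') Vw' <-]; rewrite ww'.
  by apply: def_and => //; apply: def_eq; exact: def_fun_var.
- by exists s => w Vw; apply: hs; exists w.
pose P t x := exists w, tame w x /\ w 0%N = t.
have [||t|x [c [d [x0 cd hP]]]] := @interval_uniform_fibre _ _ om P a b _ _ ab.
- apply: (def_exN (N := N) (P := fun w e => tame w (e 1%N) /\ w 0%N = e 0%N)).
    by move=> w w' e ww' [/(tame_ext ww') tw' <-]; rewrite ww'.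
  apply: def_and; last by apply: def_eq; exact: def_fun_var.
  exact: (def_ren (fun i => if i is j.+1 then j else (N + 1)%N) def_tame).
- by move=> t x y y0 yx [w [/(tame_mono y0 yx) tw wt]]; exists w.
- move=> /hab[w [Vw wt]]; have [x x0 ix] := iso w Vw.
  (* [M] bounds every coordinate, so [w] is tame for the smaller of its isolation radius and
     [M^-1]. *)
  pose M := 1 + \sum_(i < N) `|w i|.
  have M0 : 0 < M by rewrite ltr_pwDl ?ltr01 ?sumr_ge0.
  have h0 : 0 < Num.min x M^-1 by rewrite lt_min x0 invr_gt0.
  exists (Num.min x M^-1) => //; exists w; split=> //; split.
    split=> // w' Vw' hw'; apply: ix => // i /hw'/lt_le_trans; apply.
    by rewrite ge_min lexx.
  move=> i iN; rewrite normrM (gtr0_norm h0).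
  apply: le_trans (_ : `|w i| * M^-1 <= _).
    by rewrite ler_wpM2l// ge_min lexx orbT.
  rewrite ler_pdivrMr// mul1r /M (bigD1 (Ordinal iN))//= addrCA lerDl.
  by rewrite addr_ge0// sumr_ge0.
exfalso.
have [|z hz] := @tame_accumulation x c d x0 cd _ N (leqnn N).
  by move=> t /hP[w [tw wt]]; exists w.
have x20 : 0 < x / 2 by rewrite divr_gt0.
(* Both [w1] and [w2] lie within [x / 2] of [z], hence within [x] of each other, but [w2] is chosen
   with its first entry strictly between [c] and that of [w1]. *)
have [w1 [[[Vw1 iw1] _] /andP[cw1 _] hw1]] := hz _ x20.
have [|w2 [[[Vw2 _] _] /andP[_ w2c] hw2]] := hz (Num.min (x / 2) (w1 0%N - c)).
  by rewrite lt_min x20 subr_gt0.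
have : w2 0%N < w1 0%N.
  apply: lt_le_trans w2c _; rewrite -lerBrDl.
  by rewrite ge_min lexx orbT.
rewrite (iw1 w2) ?ltxx// => i iN.
have := hw1 i iN; have := hw2 i iN; rewrite lt_min => /andP[+ _].
by rewrite !ltr_norml => /andP[h1 h2] /andP[h3 h4]; apply/andP; split; lra.
Qed.

End IsolatedPoints.

(** * Differentials of exponential terms *)

(** Differentiation is syntactic so that the Jacobian condition is a formula, meaningful in [K1] and
    in [K2] alike. *)
Fixpoint pderiv (j : nat) (t : term) : term :=
  match t with
  | Var i => if i == j then One else Zero
  | Zero | One => Zero
  | Add t1 t2 => Add (pderiv j t1) (pderiv j t2)
  | Opp t1 => Opp (pderiv j t1)
  | Mul t1 t2 => Add (Mul (pderiv j t1) t2) (Mul t1 (pderiv j t2))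
  | Exp t1 => Mul (Exp t1) (pderiv j t1)
  end.

Lemma pderiv_closed n j t : term_closed n t -> term_closed n (pderiv j t).
Proof.
elim: t => //= [i _|t1 IH1 t2 IH2|t1 IH1 t2 IH2|t1 IH1 c1]; first by case: ifP.
- by move=> /andP[/IH1-> /IH2->].
- by move=> /andP[c1 c2]; rewrite IH1// IH2// c1 c2.
- by rewrite c1 IH1.
Qed.

Definition tsum (I : Type) (s : seq I) (F : I -> term) : term :=
  foldr (fun i => Add (F i)) Zero s.

Definition tprod (I : Type) (s : seq I) (F : I -> term) : term :=
  foldr (fun i => Mul (F i)) One s.

(** The Leibniz expansion of the determinant, written as a term. *)
Definition tdet (n : nat) (M : 'I_n -> 'I_n -> term) : term :=
  tsum (enum {: 'S_n}) (fun s : 'S_n =>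
    let p := tprod (enum 'I_n) (fun i => M i (s i)) in
    if odd_perm s then Opp p else p).

Lemma tdet_closed m n (M : 'I_n -> 'I_n -> term) :
  (forall i j, term_closed m (M i j)) -> term_closed m (tdet M).
Proof.
move=> cM; rewrite /tdet.
elim: (enum {: 'S_n}) => //= s ss ->; rewrite andbT.
have : term_closed m (tprod (enum 'I_n) (fun i => M i (s i))).
  by elim: (enum 'I_n) => //= i r ->; rewrite cM.
by case: ifP.
Qed.

Lemma eval_tdet (K : realFieldType) (E : K -> K) e n (M : 'I_n -> 'I_n -> term) :
  eval E e (tdet M) = \det (\matrix_(i, j) eval E e (M i j)).
Proof.
have sumE I (s : seq I) F : eval E e (tsum s F) = \sum_(i <- s) eval E e (F i).
  by elim: s => /= [|i s ->]; rewrite ?big_nil ?big_cons.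
have prodE I (s : seq I) F : eval E e (tprod s F) = \prod_(i <- s) eval E e (F i).
  by elim: s => /= [|i s ->]; rewrite ?big_nil ?big_cons.
rewrite sumE /determinant big_enum/=; apply: eq_bigr => s _.
have <- : eval E e (tprod (enum 'I_n) (fun i => M i (s i))) =
    \prod_i (\matrix_(i, j) eval E e (M i j)) i (s i).
  by rewrite prodE big_enum/=; apply: eq_bigr => i _; rewrite mxE.
by case: ifP => _ /=; rewrite ?expr1 ?expr0 ?mulN1r ?mul1r.
Qed.

(** * Total differentiability in finitely many coordinates *)

Section Differential.
Variables (K : realFieldType) (N : nat).
Implicit Types (F G : (nat -> K) -> K) (w : nat -> K) (d : nat -> K).

Definition close w (r : K) w' : Prop := forall i, (i < N)%N -> `|w' i - w i| <= r.

(** Fréchet differentiability with gradient [d] for the maximum norm of the first [N] coordinates;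
    the error is bounded over a whole box of radius [r] instead of being divided by the norm of the
    increment. *)
Definition diff_at F w d : Prop := forall eps, 0 < eps ->
  \forall r \near 0^'+, forall w', close w r w' ->
    `|F w' - F w - \sum_(j < N) d j * (w' j - w j)| <= eps * r.

Lemma near_rightP (P : K -> Prop) :
  (\forall r \near 0^'+, P r) <-> exists2 x, 0 < x & forall r, 0 < r < x -> P r.
Proof.
split=> [|[x x0 hx]].
  move=> [x /= x0 hx]; exists x => // r /andP[r0 rx]; apply: hx => //=.
  by rewrite sub0r normrN gtr0_norm.
by near=> r; apply: hx; apply/andP; split; near: r;
  [exact: nbhs_right_gt|exact: nbhs_right_lt].
Unshelve. all: by end_near. Qed.

Lemma diff_at_lipschitz F w d : diff_at F w d ->
  exists2 A, 0 < A & \forall r \near 0^'+, forall w', close w r w' ->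
    `|F w' - F w| <= A * r.
Proof.
(* The summand [1] absorbs the error taken with [eps = 1], and the sum bounds the linear part. *)
move=> /(_ 1 ltr01) dF; exists (1 + \sum_(j < N) `|d j|).
  by rewrite ltr_pwDl// sumr_ge0.
near=> r => w' ww'.
have -> : F w' - F w = (F w' - F w - \sum_(j < N) d j * (w' j - w j)) +
  \sum_(j < N) d j * (w' j - w j) by rewrite subrK.
apply: le_trans (ler_normD _ _) _; rewrite mulrDl lerD//.
  by move: w' ww'; near: r.
apply: le_trans (ler_norm_sum _ _ _) _; rewrite mulr_suml ler_sum// => j _.
by rewrite normrM ler_wpM2l// ww'.
Unshelve. all: by end_near. Qed.

Lemma diff_at_cst (c : K) w d : (forall j, (j < N)%N -> d j = 0) ->
  diff_at (fun=> c) w d.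
Proof.
move=> d0 eps eps0; near=> r => w' _.
rewrite subrr sub0r normrN big1 ?normr0 => [|j _]; last by rewrite d0 ?mul0r.
by rewrite mulr_ge0 ?(ltW eps0)//; near: r; exact: nbhs_right_ge.
Unshelve. all: by end_near. Qed.

Lemma diff_at_var i w : (i < N)%N -> diff_at (fun w => w i) w (fun j => (i == j)%:R).
Proof.
move=> iN eps eps0; near=> r => w' _.
rewrite (bigD1 (Ordinal iN))//= eqxx mul1r big1 => [|j /negPf ji]; last first.
  by rewrite (_ : (i == j) = false) ?mul0r// eq_sym; exact: ji.
rewrite addr0 subrr normr0.
by rewrite mulr_ge0 ?(ltW eps0)//; near: r; exact: nbhs_right_ge.
Unshelve. all: by end_near. Qed.

Lemma diff_atD F G w d d' : diff_at F w d -> diff_at G w d' ->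
  diff_at (fun w => F w + G w) w (fun j => d j + d' j).
Proof.
move=> dF dG eps eps0; have e20 : 0 < eps / 2 by rewrite divr_gt0.
near=> r => w' ww'.
have hF : `|F w' - F w - \sum_(j < N) d j * (w' j - w j)| <= eps / 2 * r.
  by move: w' ww'; near: r; exact: dF.
have hG : `|G w' - G w - \sum_(j < N) d' j * (w' j - w j)| <= eps / 2 * r.
  by clear hF; move: w' ww'; near: r; exact: dG.
under eq_bigr do rewrite mulrDl.
rewrite big_split/=.
set x := \sum_(i < N) _ in hF *; set y := \sum_(i < N) _ in hG *.
have -> : F w' + G w' - (F w + G w) - (x + y) = (F w' - F w - x) + (G w' - G w - y).
  by lra.
by apply: le_trans (ler_normD _ _) _; lra.
Unshelve. all: by end_near. Qed.

Lemma diff_atN F w d : diff_at F w d -> diff_at (fun w => - F w) w (fun j => - d j).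
Proof.
move=> dF eps eps0; apply: filterS (dF eps eps0) => r hr w' /hr; congr (_ <= _).
under [in RHS]eq_bigr do rewrite mulNr.
by rewrite sumrN -normrN; congr `|_|; lra.
Qed.

(** The error is [G w] times that of [F], plus [F w] times that of [G], plus the product of the
    increments, which the Lipschitz bounds make quadratic in [r]. Each part gets a third of
    [eps * r]. *)
Lemma diff_atM F G w d d' : diff_at F w d -> diff_at G w d' ->
  diff_at (fun w => F w * G w) w (fun j => d j * G w + F w * d' j).
Proof.
move=> dF dG eps eps0.
have [A A0 lF] := diff_at_lipschitz dF; have [B B0 lG] := diff_at_lipschitz dG.
pose eF := eps / 3 / (`|G w| + 1); pose eG := eps / 3 / (`|F w| + 1).
have G10 : 0 < `|G w| + 1 by rewrite ltr_wpDl.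
have F10 : 0 < `|F w| + 1 by rewrite ltr_wpDl.
have AB0 : 0 < A * B by rewrite mulr_gt0.
have eF0 : 0 < eF by rewrite !divr_gt0.
have eG0 : 0 < eG by rewrite !divr_gt0.
have eAB : 0 < eps / 3 / (A * B) by rewrite !divr_gt0.
near=> r => w' ww'.
have r0 : 0 < r by near: r; exact: nbhs_right_gt.
have rAB : A * B * r <= eps / 3.
  by rewrite mulrC -ler_pdivlMr//; near: r; exact: nbhs_right_le.
have hF : `|F w' - F w - \sum_(j < N) d j * (w' j - w j)| <= eF * r.
  by move: w' ww'; near: r; exact: dF.
have hG : `|G w' - G w - \sum_(j < N) d' j * (w' j - w j)| <= eG * r.
  by clear hF; move: w' ww'; near: r; exact: dG.
have lF' : `|F w' - F w| <= A * r by clear hF hG; move: w' ww'; near: r.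
have lG' : `|G w' - G w| <= B * r by clear hF hG lF'; move: w' ww'; near: r.
under eq_bigr => j _.
  rewrite (_ : _ * _ = G w * (d j * (w' j - w j)) + F w * (d' j * (w' j - w j)));
    last by lra.
  over.
rewrite big_split/= -!mulr_sumr.
set x := \sum_(i < N) _ in hF *; set y := \sum_(i < N) _ in hG *.
have -> : F w' * G w' - F w * G w - (G w * x + F w * y) =
  G w * (F w' - F w - x) + F w * (G w' - G w - y) + (F w' - F w) * (G w' - G w) by lra.
apply: le_trans (ler_normD _ _) _.
have -> : eps * r = eps / 3 * r + eps / 3 * r + eps / 3 * r by lra.
apply: lerD.
  apply: le_trans (ler_normD _ _) _; rewrite !normrM; apply: lerD.
    apply: le_trans (ler_wpM2l _ hF) _ => //.
    rewrite /eF mulrA ler_wpM2r ?(ltW r0)// mulrCA ger_pMr ?divr_gt0//.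
    by rewrite ler_pdivrMr// mul1r lerDl.
  apply: le_trans (ler_wpM2l _ hG) _ => //.
  rewrite /eG mulrA ler_wpM2r ?(ltW r0)// mulrCA ger_pMr ?divr_gt0//.
  by rewrite ler_pdivrMr// mul1r lerDl.
rewrite normrM; apply: le_trans (ler_pM _ _ lF' lG') _ => //.
by rewrite mulrACA mulrA ler_wpM2r ?(ltW r0).
Unshelve. all: by end_near. Qed.

(** Half of the error is that of [g] at the increment of [F], compared with [r] by the Lipschitz
    bound; the other half is [g'] times the error of [F]. *)
Lemma diff_at_comp (g : K -> K) (g' : K) F w d :
  (forall eps, 0 < eps -> exists2 x, 0 < x & forall s, `|s| <= x ->
     `|g (F w + s) - g (F w) - g' * s| <= eps * `|s|) ->
  diff_at F w d -> diff_at (fun w => g (F w)) w (fun j => g' * d j).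
Proof.
move=> dg dF eps eps0; have [A A0 lF] := diff_at_lipschitz dF.
have eA : 0 < eps / 2 / A by rewrite !divr_gt0.
have [x x0 hx] := dg _ eA.
pose eF := eps / 2 / (`|g'| + 1).
have g10 : 0 < `|g'| + 1 by rewrite ltr_wpDl.
have eF0 : 0 < eF by rewrite !divr_gt0.
have xA : 0 < x / A by rewrite divr_gt0.
near=> r => w' ww'.
have r0 : 0 < r by near: r; exact: nbhs_right_gt.
have rx : A * r <= x.
  by rewrite mulrC -ler_pdivlMr//; near: r; exact: nbhs_right_le.
have hF : `|F w' - F w - \sum_(j < N) d j * (w' j - w j)| <= eF * r.
  by move: w' ww'; near: r; exact: dF.
have lF' : `|F w' - F w| <= A * r by clear hF; move: w' ww'; near: r.
under eq_bigr do rewrite -mulrA.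
rewrite -mulr_sumr; set y := \sum_(i < N) _ in hF *.
have hg := hx _ (le_trans lF' rx).
rewrite (addrC (F w)) subrK in hg.
have -> : g (F w') - g (F w) - g' * y =
  (g (F w') - g (F w) - g' * (F w' - F w)) + g' * (F w' - F w - y) by lra.
apply: le_trans (ler_normD _ _) _.
have -> : eps * r = eps / 2 * r + eps / 2 * r by lra.
apply: lerD.
  apply: le_trans hg _; apply: le_trans (ler_wpM2l (ltW eA) lF') _.
  by rewrite mulrA divfK// gt_eqF.
rewrite normrM; apply: le_trans (ler_wpM2l _ hF) _ => //.
rewrite /eF mulrA ler_wpM2r ?(ltW r0)// mulrCA ger_pMr ?divr_gt0//.
by rewrite ler_pdivrMr// mul1r lerDl.
Unshelve. all: by end_near. Qed.

End Differential.

Section TermDifferential.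
Variables (K : realFieldType) (E : K -> K).
Hypothesis hE : EXP_field E.

Lemma exp_taylor1 (x eps : K) : 0 < eps -> exists2 y, 0 < y & forall s, `|s| <= y ->
  `|E (x + s) - E x - E x * s| <= eps * `|s|.
Proof.
move=> eps0; have [_ /(_ x)[/derivable_nbhs/eqaddoP + DE]] := hE.
(* The radius is halved because the neighbourhood is an open ball while [s] may satisfy equality. *)
move=> /(_ eps eps0)[y /= y0 hy]; exists (y / 2); first by rewrite divr_gt0.
move=> s sy; have := hy s.
rewrite /= sub0r normrN; have -> : `|s| < y by lra.
move=> /(_ isT); congr (`|_| <= _); rewrite DE /=.
rewrite !fctE/= /shift/=.
by rewrite -![_ *: _]/(_ * _) mulr1 (addrC s); lra.
Qed.

Lemma diff_at_term N t w : term_closed N t ->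
  diff_at N (fun w => eval E w t) w (fun j => eval E w (pderiv j t)).
Proof.
elim: t => /= [i iN|_|_|t1 IH1 t2 IH2|t1 IH1|t1 IH1 t2 IH2|t1 IH1].
- have -> : (fun j => eval E w (if i == j then One else Zero)) = fun j => (i == j)%:R.
    by apply/funext => j; case: ifP.
  exact: diff_at_var.
- exact: diff_at_cst.
- exact: diff_at_cst.
- by move=> /andP[/IH1 h1 /IH2 h2]; exact: diff_atD.
- by move=> /IH1 h1; exact: diff_atN.
- by move=> /andP[/IH1 h1 /IH2 h2]; exact: diff_atM.
- by move=> /IH1 h1; apply: diff_at_comp h1 => eps; exact: exp_taylor1.
Qed.

End TermDifferential.

(** * Khovanskii systems *)

(** From index [n.+1] on, [inord] falls back to coordinate [0]; terms closed at [n.+1] never read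
    these entries. *)
Definition row_env (K : Type) (n : nat) (v : 'rV[K]_n.+1) (i : nat) : K := v 0 (inord i).

Definition khovanskii_formula (n : nat) (t : 'I_n.+1 -> term) : formula :=
  And (conj n.+1 (fun i => Eq (t (inord i)) Zero))
      (Not (Eq (tdet (fun i j : 'I_n.+1 => pderiv j (t i))) Zero)).

Lemma conj_closed m k F :
  (forall i, (i < k)%N -> formula_closed m (F i)) -> formula_closed m (conj k F).
Proof.
move=> cF; have : {in iota 0 k, forall i, formula_closed m (F i)}.
  by move=> i; rewrite mem_iota => /cF.
rewrite /conj; elim: (iota 0 k) => //= i s IHs hs; rewrite hs ?mem_head//=.
by apply: IHs => j js; apply: hs; rewrite inE js orbT.
Qed.

Lemma khovanskii_formula_qf n (t : 'I_n.+1 -> term) :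
  quantifier_free (khovanskii_formula t).
Proof.
by apply: qf_And => //; exact: qf_conj.
Qed.

Lemma khovanskii_formula_closed n (t : 'I_n.+1 -> term) :
  (forall i, term_closed n.+1 (t i)) -> formula_closed n.+1 (khovanskii_formula t).
Proof.
move=> ct; have cA f g : formula_closed n.+1 f -> formula_closed n.+1 g ->
    formula_closed n.+1 (And f g) by move=> /= -> ->.
apply: cA; first by apply: conj_closed => i _ /=; rewrite ct.
rewrite /= andbT; apply: tdet_closed => i j; exact: pderiv_closed.
Qed.

Lemma sat_khovanskii (K : realFieldType) (E : K -> K) n (t : 'I_n.+1 -> term) w :
  sat E w (khovanskii_formula t) <->
  (forall i, eval E w (t i) = 0) /\
  \det (\matrix_(i < n.+1, j < n.+1) eval E w (pderiv j (t i))) != 0.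
Proof.
rewrite -eval_tdet sat_And sat_conj.
split=> [[h1 /eqP h2]|[h1 /eqP h2]]; split=> // i; last by rewrite /= h1.
by have /= := h1 i (ltn_ord i); rewrite inord_val.
Qed.

(* Near [w] the system is [J (w' - w) + o(w' - w)] with [J] invertible. *)
Lemma khovanskii_isolated (K : realFieldType) (E : K -> K) n (t : 'I_n.+1 -> term) w :
  EXP_field E -> (forall i, term_closed n.+1 (t i)) ->
  sat E w (khovanskii_formula t) ->
  exists2 x, 0 < x & isolated n.+1 (fun w => sat E w (khovanskii_formula t)) w x.
Proof.
move=> hE ct /sat_khovanskii[tw0]; set J := (\matrix_(i, j) _) => detJ.
have Ju : J \in unitmx by rewrite unitmxE unitfE.
(* [C] exceeds every absolute row sum of the inverse Jacobian, so an error factor [(2 * C)^-1] is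
   turned into at most one half. *)
pose C := 1 + \sum_i \sum_j `|invmx J i j|.
have C0 : 0 < C by rewrite ltr_pwDl// sumr_ge0// => i _; rewrite sumr_ge0.
have eta0 : 0 < (2 * C)^-1 by rewrite invr_gt0 mulr_gt0.
have /near_rightP[x x0 hx] : \forall r \near 0^'+, forall i : 'I_n.+1,
    forall w', close n.+1 w r w' -> `|eval E w' (t i) - eval E w (t i) -
     \sum_(j < n.+1) eval E w (pderiv j (t i)) * (w' j - w j)| <= (2 * C)^-1 * r.
  apply: filter_forall => i; exact: (diff_at_term hE w (ct i) eta0).
exists x => // w' /sat_khovanskii[tw'0 _] ww'.
pose r := \big[Num.max/0]_(i < n.+1) `|w' i - w i|.
have ler (i : 'I_n.+1) : `|w' i - w i| <= r by exact: (le_bigmax _ (fun i : 'I_n.+1 => `|w' i - w i|)).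
have rx : r < x by apply: bigmax_lt => // i _; exact: ww'.
have [r0|r0] := leP r 0.
  by apply/eqP; rewrite -subr_eq0 -normr_le0 (le_trans (ler ord0)).
exfalso.
pose h : 'cV[K]_n.+1 := \col_i (w' i - w i).
have Jh i : `|(J *m h) i 0| <= (2 * C)^-1 * r.
  have := hx r _ i w'; rewrite r0 rx => /(_ isT); rewrite tw0 tw'0 subrr sub0r normrN.
  have -> : \sum_(j < n.+1) eval E w (pderiv j (t i)) * (w' j - w j) = (J *m h) i 0.
    by rewrite mxE; apply: eq_bigr => j _; rewrite !mxE.
  by apply=> j jn; exact: (ler (Ordinal jn)).
(* Here [r] is the maximum norm of [h], and [h] is recovered as [invmx J *m (J *m h)], where
   [J *m h] is a pure error term because both points are zeros of the system. *)
have : r <= r / 2.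
  apply: bigmax_le => [|i _]; first by rewrite divr_ge0// ltW.
  have -> : w' i - w i = (invmx J *m (J *m h)) i 0 by rewrite mulKmx// mxE.
  rewrite mxE; apply: le_trans (ler_norm_sum _ _ _) _.
  apply: le_trans (_ : \sum_j `|invmx J i j| * ((2 * C)^-1 * r) <= _).
    by apply: ler_sum => j _; rewrite normrM ler_wpM2l.
  rewrite -mulr_suml; apply: le_trans (_ : C * ((2 * C)^-1 * r) <= _).
    rewrite ler_wpM2r ?mulr_ge0 ?(ltW eta0) ?(ltW r0)//.
    rewrite /C [X in _ <= 1 + X](bigD1 i)//= addrCA lerDl addr_ge0// sumr_ge0// => k _.
    by rewrite sumr_ge0.
  by rewrite mulrA invfM mulrCA mulfV ?gt_eqF// mulr1 mulrC.
lra.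
Qed.

(** The functions given by terms form an [E]-ring containing the coordinates and the constants, the
    latter because elements of the smallest [E]-ring of [K] are values of closed terms. *)
Lemma exp_poly_term (K : realFieldType) (E : K -> K) n (f : 'rV[K]_n.+1 -> K) :
  exp_poly E (smallest (is_Ering E) set0) f ->
  exists2 t, term_closed n.+1 t & f = fun v => eval E (row_env v) t.
Proof.
apply: (@smallest_sub _ _ _
  [set f | exists2 t, term_closed n.+1 t & f = fun v => eval E (row_env v) t]).
  split.
  - by exists One => //; apply/funext.
  - move=> g h [s cs ->] [t ct ->]; exists (Add s (Opp t)) => //=; by rewrite cs ct.
  - move=> g h [s cs ->] [t ct ->]; exists (Mul s t) => //=; by rewrite cs ct.
  - by move=> g [s cs ->]; exists (Exp s).
move=> _ [[a Aa <-]|[j _ <-]]; last first.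
  by exists (Var j) => /=; [exact: ltn_ord|apply/funext => v; rewrite /row_env inord_val].
have : (smallest (is_Ering E) set0 `<=`
    [set a | exists2 t, term_closed 0 t & forall e, a = eval E e t]).
  apply: smallest_sub => //; split.
  - by exists One.
  - move=> x y [s cs hs] [t ct ht]; exists (Add s (Opp t)) => [/=|e]; first by rewrite cs ct.
    by rewrite /= -hs -ht.
  - move=> x y [s cs hs] [t ct ht]; exists (Mul s t) => [/=|e]; first by rewrite cs ct.
    by rewrite /= -hs -ht.
  - by move=> x [s cs hs]; exists (Exp s) => // e; rewrite /= -hs.
move=> /(_ a Aa)[t ct ht]; exists t; first exact: term_closed_le ct.
by apply/funext => v; rewrite -ht.
Qed.

(** The total differential is applied to the increment [h *: delta_mx 0 j] in the box of radius
    [|h|]; only the summand of index [j] survives. *)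
Lemma derive_term (K : realFieldType) (E : K -> K) n (t : term) (a : 'rV[K]_n.+1) j :
  EXP_field E -> term_closed n.+1 t ->
  'D_(delta_mx 0 j) (fun v => eval E (row_env v) t) a =
  eval E (row_env a) (pderiv j t).
Proof.
move=> hE ct; apply: cvg_lim => //; apply/cvgrPdist_le => eps eps0.
have /near_rightP[x x0 hx] := diff_at_term hE (row_env a) ct eps0.
exists x => //= h; rewrite /ball_/= sub0r normrN => hx' h0.
have h_gt0 : 0 < `|h| by rewrite normr_gt0.
have := hx `|h|; rewrite h_gt0 hx' => /(_ isT (row_env (h *: delta_mx 0 j + a))).
have envE i : (i < n.+1)%N ->
    row_env (h *: delta_mx 0 j + a) i - row_env a i = h * (i == j :> nat)%:R.
  move=> iN; rewrite /row_env !mxE addrK eqxx/=; congr (h * _%:R).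
  by rewrite -val_eqE/= inordK.
have clo : close n.+1 (row_env a) `|h| (row_env (h *: delta_mx 0 j + a)).
  move=> i iN; rewrite envE// normrM ger_pMr//.
  by case: (_ == _); rewrite ?normr1 ?normr0.
move=> /(_ clo); rewrite (bigD1 j)//= envE// eqxx mulr1 big1 ?addr0 => [|k kj]; last first.
  by move: kj; rewrite -val_eqE envE//= => /negPf->; rewrite !mulr0.
set u := eval E _ _ - _; set p := eval E _ _ => hu.
have -> : p - h^-1 *: u = - (h^-1 * (u - p * h)).
  rewrite (_ : h^-1 *: u = h^-1 * u)//.
  by rewrite [h^-1 * (u - _)]mulrBr mulrCA mulVf// mulr1 opprB.
by rewrite normrN normrM normfV mulrC ler_pdivrMr.
Qed.

(** Once its functions are written as terms, the system is one formula for both fields: [a]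
    satisfies it in [K1], and in [K2] its solutions are isolated, so their first entries form a
    finite set. *)
Lemma ecl_coded (K1 K2 : realFieldType) (E1 : K1 -> K1) (E2 : K2 -> K2) (z : K1) :
  EXP_field E1 -> EXP_field E2 -> o_minimal E2 ->
  ecl E1 set0 z -> coded E1 E2 z.
Proof.
move=> hE1 hE2 om2 [n [f [a [fexp [fa detJ] <-]]]].
have /choice[t tP] i : exists t, term_closed n.+1 t /\
    f i = fun v => eval E1 (row_env v) t.
  by have [t ct ft] := exp_poly_term (fexp i); exists t.
have ct i : term_closed n.+1 (t i) by have [] := tP i.
have [s hs] : exists s : seq K2, forall w,
    sat E2 w (khovanskii_formula t) -> w 0%N \in s.
  apply: (isolated_finite (N := n.+1) om2) => //.
  - by exists (khovanskii_formula t).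
  - move=> w w' ww'.
    by rewrite (sat_closed E2 ww' (khovanskii_formula_closed ct)).
  - by move=> w; exact: khovanskii_isolated.
exists (khovanskii_formula t), (row_env a), s; split=> //.
- exact: khovanskii_formula_qf.
- apply/sat_khovanskii; split=> [i|].
    by have [_ fi] := tP i; rewrite -(fa i) fi.
  rewrite (_ : \matrix_(i, j) _ = jacobian_mx f a)//.
  by apply/matrixP => i j; rewrite !mxE; have [_ ->] := tP i; rewrite derive_term.
- by rewrite /row_env; congr (a 0 _); apply/val_inj; rewrite /= inordK.
Qed.

Theorem theorem2p6 (K1 K2 : realFieldType) (E1 : K1 -> K1) (E2 : K2 -> K2)
    (hE1 : EXP_field E1) (hE2 : EXP_field E2)
    (om1 : o_minimal E1) (om2 : o_minimal E2)
    (hth : forall f : formula, existential_theory E1 f -> models E2 f) :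
  exists phi : K1 -> K2, Lexp_embedding E1 E2 (ecl E1 set0) phi.
Proof. by apply: (coded_embedding hth) => z; exact: ecl_coded. Qed.
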